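(* Let $C,\sigma>0$ be fixed and, for $\alpha>0$, let $W^\alpha(\varphi,z)$, $f^\alpha(z)$, $H^\alpha_{11}(z)$, $H^\alpha_{22}(z)$ be as defined in the context. There exist unique $\alpha_1>0$ and $z_1\in(0,1)$ such that $f^{\alpha_1}(z_1)=0$ and $\frac{\mathrm{d}f^{\alpha_1}}{\mathrm{d}z}(z_1)=0$; there exist a unique $\tilde z\in(0,z_1)$ and a unique $\tilde\alpha\in(0,\alpha_1)$ such that $f^{\tilde\alpha}(\tilde z)=0$ and $H^{\tilde\alpha}_{11}(\tilde z)=0$; and $f^{\tilde\alpha}$ has exactly one further zero $\tilde{\tilde z}\neq\tilde z$ in $(0,1)$. One has $e^{-1}<\tilde z<z_1<\tilde{\tilde z}<1$, $\tilde\alpha=\frac{1-\tilde z^2}{\tilde z}$, and, to within $10^{-3}$, $\alpha_1\approx1.853$, $z_1\approx0.485$, $\tilde\alpha\approx1.768$, $\tilde z\approx0.451$, $\tilde{\tilde z}\approx0.529$. The equilibrium points with $\varphi=0$, i.e. the points $(0,z)$ with $z\in(0,1)$ and $f^\alpha(z)=0$, are classified as follows (no such point has $z\le e^{-1}$). (i) If $0<\alpha<\tilde\alpha$, there are exactly two: one with $z\in(e^{-1},\tilde z)$, where $H^\alpha_{11}(z)>0$ and $H^\alpha_{22}(z)>0$, which is stable; and one with $z\in(\tilde{\tilde z},1)$, where $H^\alpha_{11}(z)<0$ and $H^\alpha_{22}(z)<0$, which is unstable. (ii) If $\alpha=\tilde\alpha$, there are exactly two: $z=\tilde z$, where $H^\alpha_{11}(z)=0$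 and $H^\alpha_{22}(z)>0$, and $z=\tilde{\tilde z}$, where $H^\alpha_{11}(z)<0$ and $H^\alpha_{22}(z)<0$; both are unstable. (iii) If $\tilde\alpha<\alpha<\alpha_1$, there are exactly two: one with $z\in(\tilde z,z_1)$, where $H^\alpha_{11}(z)<0$ and $H^\alpha_{22}(z)>0$, and one with $z\in(z_1,\tilde{\tilde z})$, where $H^\alpha_{11}(z)<0$ and $H^\alpha_{22}(z)<0$; both are unstable. (iv) If $\alpha=\alpha_1$, there is exactly one: $z=z_1$, where $H^\alpha_{11}(z)<0$ and $H^\alpha_{22}(z)=0$; it is unstable. (v) If $\alpha>\alpha_1$, there are none.
   Context: For $\alpha>0$ (the ratio $\alpha=s/\sigma$ of the dislocation strength $s>0$ to the disclination strength $\sigma>0$), the limiting renormalized energy of a wedge disclination fixed at the center of the unit disk and an edge dislocation at $(z,0)$, $z\in(0,1)$, with orientation angle $\varphi\in\mathbb{R}$, is $$W^\alpha(\varphi,z)=2C\alpha^2\sigma^2\bigl(z^2\cos^2\varphi+\log(1-z^2)\bigr)+4C\alpha\sigma^2\,z\log z\,\cos\varphi+\tfrac C2\sigma^2,$$ with $C>0$ a constant. At $\varphi=0$ one has $\partial_\varphi W^\alpha(0,z)=0$ for all $z$. The force is $$f^\alpha(z):=-\partial_zW^\alpha(0,z)=-4C\alpha\sigma^2\Bigl(1+\log z-\frac{\alpha z^3}{1-z^2}\Bigr).$$ The Hessian $\nabla^2_{(\varphi,z)}W^\alpha(0,z)$ is diagonal, with entries $$H^\alpha_{11}(z)=-4C\alpha\sigma^2\,z(\alpha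 z+\log z),\qquad H^\alpha_{22}(z)=4C\alpha\sigma^2\Bigl(\frac1z+\alpha\frac{(z^2-3)z^2}{(1-z^2)^2}\Bigr).$$ An equilibrium (stationary) point is a critical point of $W^\alpha$ with respect to $(\varphi,z)$. It is called stable if it is a local minimum of $W^\alpha$, and unstable otherwise. *)

(* Defs.v *)
From Stdlib Require Export Reals.
From Coquelicot Require Export Coquelicot.
From Stdlib Require Import Lra.
Open Scope R_scope.

(* Renormalized energy of a wedge disclination of strength [sigma] at the center
   of the unit disk and an edge dislocation of strength [alpha * sigma] and
   orientation [phi] at [(z, 0)], for [0 < z < 1]. *)
Definition W (C sigma alpha phi z : R) : R :=
  2 * C * alpha ^ 2 * sigma ^ 2 * (z ^ 2 * cos phi ^ 2 + ln (1 - z ^ 2))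
  + 4 * C * alpha * sigma ^ 2 * z * ln z * cos phi
  + C / 2 * sigma ^ 2.

Definition force (C sigma alpha z : R) : R :=
  - Derive (fun z' => W C sigma alpha 0 z') z.

(* Diagonal entries, at [(0, z)], of the Hessian of [W] with respect to
   [(phi, z)]. *)
Definition hess11 (C sigma alpha z : R) : R :=
  Derive_n (fun phi => W C sigma alpha phi z) 2 0.

Definition hess22 (C sigma alpha z : R) : R :=
  Derive_n (fun z' => W C sigma alpha 0 z') 2 z.

Definition equilibrium (C sigma alpha phi z : R) : Prop :=
  0 < z < 1 /\
  is_derive (fun phi' => W C sigma alpha phi' z) phi 0 /\
  is_derive (fun z' => W C sigma alpha phi z') z 0.

(* [W] is meaningful only on [R * (0, 1)], [ln] being total, hence the guard
   [0 < z' < 1]. *)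
Definition local_minimum (C sigma alpha phi z : R) : Prop :=
  locally_2d (fun phi' z' =>
    0 < z' < 1 -> W C sigma alpha phi z <= W C sigma alpha phi' z') phi z.

Definition stable (C sigma alpha phi z : R) : Prop :=
  equilibrium C sigma alpha phi z /\ local_minimum C sigma alpha phi z.

Definition unstable (C sigma alpha phi z : R) : Prop :=
  equilibrium C sigma alpha phi z /\ ~ local_minimum C sigma alpha phi z.

Lemma is_derive_W_phi (C sigma alpha phi z : R) :
  is_derive (fun phi' => W C sigma alpha phi' z) phi
    (- 4 * C * alpha ^ 2 * sigma ^ 2 * z ^ 2 * cos phi * sin phi
     - 4 * C * alpha * sigma ^ 2 * z * ln z * sin phi).
Proof. unfold W; auto_derive; [trivial | ring]. Qed.

Lemma is_derive_W_phi0 (C sigma alpha z : R) :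
  is_derive (fun phi => W C sigma alpha phi z) 0 0.
Proof.
  unfold W; auto_derive; [trivial | rewrite sin_0; ring].
Qed.

Lemma is_derive_W_z (C sigma alpha z : R) : 0 < z < 1 ->
  is_derive (fun z' => W C sigma alpha 0 z') z
    (4 * C * alpha * sigma ^ 2 * (1 + ln z - alpha * z ^ 3 / (1 - z ^ 2))).
Proof.
  intros Hz; unfold W; rewrite cos_0.
  assert (0 < 1 - z ^ 2) by nra.
  auto_derive; [repeat split; lra | field; repeat split; nra].
Qed.

Lemma Derive_W_z (C sigma alpha z : R) : 0 < z < 1 ->
  Derive (fun z' => W C sigma alpha 0 z') z =
  4 * C * alpha * sigma ^ 2 * (1 + ln z - alpha * z ^ 3 / (1 - z ^ 2)).
Proof. intros Hz; apply is_derive_unique, is_derive_W_z, Hz. Qed.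

Lemma force_formula (C sigma alpha z : R) : 0 < z < 1 ->
  force C sigma alpha z =
  - 4 * C * alpha * sigma ^ 2 * (1 + ln z - alpha * z ^ 3 / (1 - z ^ 2)).
Proof.
  intros Hz; unfold force.
  rewrite (Derive_W_z C sigma alpha z Hz); unfold Rdiv; ring.
Qed.

Lemma hess11_formula (C sigma alpha z : R) :
  hess11 C sigma alpha z =
  - 4 * C * alpha * sigma ^ 2 * z * (alpha * z + ln z).
Proof.
  unfold hess11; simpl Derive_n.
  rewrite (Derive_ext _ _ _
    (fun phi => is_derive_unique _ _ _ (is_derive_W_phi C sigma alpha phi z))).
  apply is_derive_unique; auto_derive; [trivial | rewrite sin_0, cos_0; ring].
Qed.

Lemma hess12_formula (C sigma alpha z : R) :
  Derive (fun z' => Derive (fun phi => W C sigma alpha phi z') 0) z = 0.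
Proof.
  rewrite (Derive_ext _ _ _
    (fun z' => is_derive_unique _ _ _ (is_derive_W_phi0 C sigma alpha z'))).
  apply Derive_const.
Qed.

Lemma hess22_formula (C sigma alpha z : R) : 0 < z < 1 ->
  hess22 C sigma alpha z =
  4 * C * alpha * sigma ^ 2 *
  (1 / z + alpha * ((z ^ 2 - 3) * z ^ 2 / (1 - z ^ 2) ^ 2)).
Proof.
  intros Hz; unfold hess22; simpl Derive_n.
  rewrite (Derive_ext_loc _ (fun z' => 4 * C * alpha * sigma ^ 2 *
    (1 + ln z' - alpha * z' ^ 3 / (1 - z' ^ 2)))).
  - assert (0 < 1 - z ^ 2) by nra.
    apply is_derive_unique; auto_derive.
    + repeat split; lra.
    + field; repeat split; nra.
  - apply (locally_interval _ z 0 1); simpl; try tauto.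
    intros y Hy0 Hy1.
    apply is_derive_unique, is_derive_W_z; split; assumption.
Qed.

Lemma equilibrium0_force (C sigma alpha z : R) :
  equilibrium C sigma alpha 0 z <-> 0 < z < 1 /\ force C sigma alpha z = 0.
Proof.
  split.
  - intros [Hz [_ H]]; split; [exact Hz |].
    apply Ropp_eq_0_compat, is_derive_unique, H.
  - intros [Hz H]; split; [exact Hz |].
    split; [apply is_derive_W_phi0 |].
    pose proof (is_derive_W_z C sigma alpha z Hz) as D.
    rewrite <- (Derive_W_z C sigma alpha z Hz) in D.
    unfold force in H.
    apply Ropp_eq_0_compat in H; rewrite Ropp_involutive in H.
    rewrite H in D; exact D.
Qed.

(* Main.v *)
Require Import Defs.
From Stdlib Require Import Reals Ranalysis5 Lra.
From Coquelicot Require Import Coquelicot.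
Open Scope R_scope.

(** With [g z = (1 + ln z) (1 - z^2) / z^3], the point [(0, z)] is an equilibrium
    exactly when [g z = alpha].  Both [g'] and [hess22] along the curve
    [alpha = g z] have the sign of a decreasing function vanishing at a single
    [z1], so [g] increases up to its maximum [alpha1 = g z1] and then decreases
    to [g 1 = 0]; [hess11] has the sign of [- (1 - z^2 + ln z)], which changes at
    a single [zt < z1].  The values [z1], [zt] and [ztt] are located by the
    intermediate value theorem.  Signs of the Hessian entries settle stability
    except at [zt], where a coupling of [phi] and [z] makes the energy decrease. *)

(** * Monotonicity and second-derivative tests in one variable *)

Lemma lt_of_derive_pos (f df : R -> R) (a b : R) :
  a < b ->
  (forall c, a <= c <= b -> is_derive f c (df c)) ->
  (forall c, a < c < b -> 0 < df c) -> f a < f b.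
Proof.
  intros Hab Hd Hpos.
  destruct (MVT_cor2 f df a b Hab) as [c [Hc Hin]].
  - intros c Hc; apply is_derive_Reals, Hd, Hc.
  - specialize (Hpos c Hin).
    assert (0 < df c * (b - a)) by (apply Rmult_lt_0_compat; lra).
    lra.
Qed.

Lemma gt_of_derive_neg (f df : R -> R) (a b : R) :
  a < b ->
  (forall c, a <= c <= b -> is_derive f c (df c)) ->
  (forall c, a < c < b -> df c < 0) -> f b < f a.
Proof.
  intros Hab Hd Hneg.
  apply Ropp_lt_cancel.
  apply (lt_of_derive_pos (fun x => - f x) (fun x => - df x)); [exact Hab | |].
  - intros c Hc; apply (is_derive_opp f), Hd, Hc.
  - intros c Hc; specialize (Hneg c Hc); lra.
Qed.

(** Since [df x / (x - x0)] tends to [l > 0], [df] has the sign of [x - x0] near [x0], so [f]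
    strictly decreases before [x0] and strictly increases after it. *)
Lemma second_derivative_min (f df : R -> R) (x0 l : R) :
  locally x0 (fun x => is_derive f x (df x)) ->
  df x0 = 0 -> is_derive df x0 l -> 0 < l ->
  locally x0 (fun x => x <> x0 -> f x0 < f x).
Proof.
  intros [d1 Hd1] H0 Hl Hpos.
  apply is_derive_Reals in Hl.
  destruct (Hl (l / 2)) as [d2 Hd2]; [lra |].
  assert (Hsign : forall h, h <> 0 -> Rabs h < d2 -> 0 < df (x0 + h) / h).
  { intros h Hh0 Hh; specialize (Hd2 h Hh0 Hh).
    rewrite H0, Rminus_0_r in Hd2; apply Rabs_def2 in Hd2; lra. }
  assert (Hd : 0 < Rmin d1 d2) by (apply Rmin_pos; apply cond_pos).
  exists (mkposreal _ Hd); intros x Hx Hne; simpl in Hx.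
  change (Rabs (x - x0) < Rmin d1 d2) in Hx.
  pose proof (Rmin_l d1 d2); pose proof (Rmin_r d1 d2).
  apply Rabs_def2 in Hx.
  assert (Hder : forall c, Rmin x x0 <= c <= Rmax x x0 ->
            is_derive f c (df c)).
  { intros c; unfold Rmin, Rmax; intros Hc; apply Hd1.
    change (Rabs (c - x0) < d1); apply Rabs_def1; destruct (Rle_dec x x0); lra. }
  destruct (Rlt_or_le x x0) as [Hlt | Hle].
  - rewrite Rmin_left, Rmax_right in Hder by lra.
    apply (gt_of_derive_neg f df); [exact Hlt | exact Hder |].
    intros c Hc.
    assert (Hs := Hsign (c - x0) ltac:(lra) ltac:(apply Rabs_def1; lra)).
    replace (x0 + (c - x0)) with c in Hs by ring.
    replace (df c) with (df c / (c - x0) * (c - x0)) by (field; lra).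
    nra.
  - rewrite Rmin_right, Rmax_left in Hder by lra.
    apply (lt_of_derive_pos f df); [lra | exact Hder |].
    intros c Hc.
    assert (Hs := Hsign (c - x0) ltac:(lra) ltac:(apply Rabs_def1; lra)).
    replace (x0 + (c - x0)) with c in Hs by ring.
    replace (df c) with (df c / (c - x0) * (c - x0)) by (field; lra).
    nra.
Qed.

Lemma second_derivative_max (f df : R -> R) (x0 l : R) :
  locally x0 (fun x => is_derive f x (df x)) ->
  df x0 = 0 -> is_derive df x0 l -> l < 0 ->
  locally x0 (fun x => x <> x0 -> f x < f x0).
Proof.
  intros Hd H0 Hl Hneg.
  assert (H : locally x0 (fun x => x <> x0 -> - f x0 < - f x)).
  { apply (second_derivative_min (fun x => - f x) (fun x => - df x) x0 (- l)).
    - revert Hd; apply filter_imp; intros x Hx; apply (is_derive_opp f), Hx.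
    - rewrite H0; ring.
    - apply (is_derive_opp df), Hl.
    - lra. }
  revert H; apply filter_imp; intros x Hx Hne; specialize (Hx Hne); lra.
Qed.

(** * Bounds for the logarithm *)

Lemma ln_lower (x : R) : 0 < x -> 1 - 1 / x <= ln x.
Proof.
  intros Hx.
  pose proof (exp_ineq1_le (- ln x)) as H.
  rewrite exp_Ropp, exp_ln in H by exact Hx.
  unfold Rdiv; lra.
Qed.

(* Partial sum of the power series of [ln ((1 + y) / (1 - y))]. *)
Definition artanh_poly (y : R) : R :=
  2 * (y + y ^ 3 / 3 + y ^ 5 / 5 + y ^ 7 / 7 + y ^ 9 / 9).

(** Both differences vanish at 0 and have an explicit positive derivative. The error term is the
    tail of the series with every denominator replaced by 11, summed geometrically. *)
Lemma artanh_bounds (y : R) : 0 < y < 1 ->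
  artanh_poly y < ln (1 + y) - ln (1 - y) <
  artanh_poly y + 2 / 11 * y ^ 11 / (1 - y ^ 2).
Proof.
  intros Hy; unfold artanh_poly; split.
  - apply Rlt_0_minus.
    replace 0 with ((fun t => ln (1 + t) - ln (1 - t) -
      2 * (t + t ^ 3 / 3 + t ^ 5 / 5 + t ^ 7 / 7 + t ^ 9 / 9)) 0)
      by (cbv beta; rewrite Rplus_0_r, Rminus_0_r, ln_1; field).
    apply (lt_of_derive_pos (fun t => ln (1 + t) - ln (1 - t) -
      2 * (t + t ^ 3 / 3 + t ^ 5 / 5 + t ^ 7 / 7 + t ^ 9 / 9))
      (fun t => 2 * t ^ 10 / (1 - t ^ 2))); [lra | |].
    + intros c Hc; assert (0 < 1 - c ^ 2) by nra.
      auto_derive; [repeat split; lra | field; repeat split; nra].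
    + intros c Hc; assert (0 < 1 - c ^ 2) by nra.
      apply Rdiv_lt_0_compat; [| lra].
      apply Rmult_lt_0_compat; [lra | apply pow_lt; lra].
  - apply Rlt_0_minus.
    replace 0 with ((fun t =>
      2 * (t + t ^ 3 / 3 + t ^ 5 / 5 + t ^ 7 / 7 + t ^ 9 / 9)
      + 2 / 11 * t ^ 11 / (1 - t ^ 2) - (ln (1 + t) - ln (1 - t))) 0)
      by (cbv beta; rewrite Rplus_0_r, Rminus_0_r, ln_1; field).
    apply (lt_of_derive_pos (fun t =>
      2 * (t + t ^ 3 / 3 + t ^ 5 / 5 + t ^ 7 / 7 + t ^ 9 / 9)
      + 2 / 11 * t ^ 11 / (1 - t ^ 2) - (ln (1 + t) - ln (1 - t)))
      (fun t => 4 / 11 * t ^ 12 / (1 - t ^ 2) ^ 2)); [lra | |].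
    + intros c Hc; assert (0 < 1 - c ^ 2) by nra.
      auto_derive; [repeat split; nra | field; repeat split; nra].
    + intros c Hc; assert (0 < 1 - c ^ 2) by nra.
      apply Rdiv_lt_0_compat; [| apply pow_lt; lra].
      apply Rmult_lt_0_compat; [lra | apply pow_lt; lra].
Qed.

(** The substitution inverts to [z = (1 - y) / (1 + y)]. At a rational [z] both bounds are rational,
    so [lra] can settle numerical claims about [ln z]. *)
Lemma ln_bounds (z y : R) : 0 < z < 1 -> y = (1 - z) / (1 + z) ->
  - (artanh_poly y + 2 / 11 * y ^ 11 / (1 - y ^ 2)) < ln z < - artanh_poly y.
Proof.
  intros Hz Ey.
  assert (Hy : 0 < y < 1).
  { rewrite Ey; split; [apply Rdiv_lt_0_compat; lra |].
    apply Rlt_div_l; lra. }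
  pose proof (artanh_bounds y Hy) as B.
  assert (E : ln (1 - y) = ln z + ln (1 + y)).
  { rewrite <- ln_mult by lra; f_equal; rewrite Ey; field; lra. }
  lra.
Qed.

(** * The equilibrium curve and its monotonicity *)

(* The ratio [alpha] for which [(0, z)] is an equilibrium. *)
Definition strength (z : R) : R := (1 + ln z) * (1 - z ^ 2) / z ^ 3.

(** This is [z ^ 4] times the derivative of [strength]; it also carries the sign of [hess22] along
    the curve [alpha = strength z]. *)
Definition turning (z : R) : R := 1 - z ^ 2 - (3 - z ^ 2) * (1 + ln z).

(** This is [z ^ 2 * (alpha * z + ln z)] at [alpha = strength z], hence the factor that decides the
    sign of [hess11] on the curve. *)
Definition tilt (z : R) : R := 1 - z ^ 2 + ln z.

Lemma is_derive_strength (z : R) : 0 < z ->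
  is_derive strength z (turning z / z ^ 4).
Proof.
  intros Hz; unfold strength, turning.
  auto_derive; [split; [exact Hz | split; [apply (pow_nonzero z 3); lra | exact I]]
    | field; lra].
Qed.

Lemma is_derive_turning (z : R) : 0 < z ->
  is_derive turning z (2 * z * ln z - (3 - z ^ 2) / z).
Proof.
  intros Hz; unfold turning.
  auto_derive; [lra | field; lra].
Qed.

Lemma is_derive_tilt (z : R) : 0 < z ->
  is_derive tilt z ((1 - 2 * z ^ 2) / z).
Proof.
  intros Hz; unfold tilt.
  auto_derive; [lra | field; lra].
Qed.

Lemma ln_neg (z : R) : 0 < z < 1 -> ln z < 0.
Proof. intros Hz; rewrite <- ln_1; apply ln_increasing; lra. Qed.

Lemma turning_decreasing (x y : R) : 0 < x -> x < y -> y <= 1 ->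
  turning y < turning x.
Proof.
  intros Hx Hxy Hy.
  apply (gt_of_derive_neg turning
    (fun z => 2 * z * ln z - (3 - z ^ 2) / z)); [exact Hxy | |].
  - intros c Hc; apply is_derive_turning; lra.
  - intros c Hc.
    pose proof (ln_neg c ltac:(lra)).
    assert (0 < (3 - c ^ 2) / c) by (apply Rdiv_lt_0_compat; nra).
    nra.
Qed.

Lemma strength_increasing (z1 x y : R) : turning z1 = 0 -> z1 < 1 ->
  0 < x -> x < y -> y <= z1 -> strength x < strength y.
Proof.
  intros H1 Hz1 Hx Hxy Hy.
  apply (lt_of_derive_pos strength (fun z => turning z / z ^ 4)); [exact Hxy | |].
  - intros c Hc; apply is_derive_strength; lra.
  - intros c Hc; apply Rdiv_lt_0_compat; [| apply pow_lt; lra].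
    rewrite <- H1; apply turning_decreasing; lra.
Qed.

Lemma strength_decreasing (z1 x y : R) : turning z1 = 0 -> 0 < z1 ->
  z1 <= x -> x < y -> y <= 1 -> strength y < strength x.
Proof.
  intros H1 Hz1 Hx Hxy Hy.
  apply (gt_of_derive_neg strength (fun z => turning z / z ^ 4)); [exact Hxy | |].
  - intros c Hc; apply is_derive_strength; lra.
  - intros c Hc.
    assert (turning c < 0) by (rewrite <- H1; apply turning_decreasing; lra).
    apply Rdiv_neg_pos; [assumption | apply pow_lt; lra].
Qed.

Lemma strength_le_max (z1 z : R) : turning z1 = 0 -> 0 < z1 < 1 ->
  0 < z <= 1 -> strength z <= strength z1.
Proof.
  intros H1 Hz1 Hz.
  destruct (Rtotal_order z z1) as [H | [-> | H]].
  - left; apply (strength_increasing z1); lra.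
  - right; reflexivity.
  - left; apply (strength_decreasing z1); lra.
Qed.

(** The derivative is positive up to [1 / sqrt 2], which exceeds 0.7. *)
Lemma tilt_increasing (x y : R) : 0 < x -> x < y -> y <= 0.7 ->
  tilt x < tilt y.
Proof.
  intros Hx Hxy Hy.
  apply (lt_of_derive_pos tilt (fun z => (1 - 2 * z ^ 2) / z)); [exact Hxy | |].
  - intros c Hc; apply is_derive_tilt; lra.
  - intros c Hc; apply Rdiv_lt_0_compat; nra.
Qed.

(** Monotonicity fails near 1, where [tilt] falls back to 0. The bound [ln x >= 1 - 1 / x] leaves a
    quantity with the factor [x ^ 2 + x - 1], positive beyond 0.62. *)
Lemma tilt_pos_right (x : R) : 0.7 <= x < 1 -> 0 < tilt x.
Proof.
  intros Hx; unfold tilt.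
  pose proof (ln_lower x ltac:(lra)).
  assert (0 < 2 - x ^ 2 - 1 / x); [| lra].
  replace (2 - x ^ 2 - 1 / x) with ((1 - x) * (x ^ 2 + x - 1) / x)
    by (field; lra).
  apply Rdiv_lt_0_compat; [apply Rmult_lt_0_compat |]; nra.
Qed.

Lemma tilt_pos (zt z : R) : tilt zt = 0 -> 0 < zt -> zt < z < 1 -> 0 < tilt z.
Proof.
  intros Ht Hzt Hz.
  destruct (Rle_or_lt 0.7 z); [apply tilt_pos_right; lra |].
  rewrite <- Ht; apply tilt_increasing; lra.
Qed.

(** * Existence and numerical location of the distinguished points *)

Lemma IVT_derive_up (f df : R -> R) (a b v : R) :
  (forall c, a <= c <= b -> is_derive f c (df c)) ->
  a < b -> f a < v < f b -> exists z, a < z < b /\ f z = v.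
Proof.
  intros Hd Hab Hv.
  destruct (IVT_interv (fun z => f z - v) a b) as [z [Hz Ez]]; try lra.
  - intros c Hc.
    apply continuity_pt_minus; [| apply continuity_pt_const; intros ? ?; reflexivity].
    apply derivable_continuous_pt; exists (df c).
    apply is_derive_Reals, Hd, Hc.
  - exists z; split; [| lra].
    split; apply Rnot_le_lt; intros Hle.
    + replace z with a in Ez by lra; lra.
    + replace z with b in Ez by lra; lra.
Qed.

Lemma IVT_derive_down (f df : R -> R) (a b v : R) :
  (forall c, a <= c <= b -> is_derive f c (df c)) ->
  a < b -> f b < v < f a -> exists z, a < z < b /\ f z = v.
Proof.
  intros Hd Hab Hv.
  destruct (IVT_derive_up (fun x => - f x) (fun x => - df x) a b (- v))
    as [z [Hz Ez]]; try lra.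
  - intros c Hc; apply (is_derive_opp f), Hd, Hc.
  - exists z; split; [exact Hz | lra].
Qed.

Lemma strength_exp : strength (exp (-1)) = 0.
Proof. unfold strength; rewrite ln_exp; unfold Rdiv; ring. Qed.

Lemma strength_1 : strength 1 = 0.
Proof. unfold strength; rewrite ln_1; field. Qed.

(** For [z <= exp (-1)] the factor [1 + ln z] is not positive. This gives the lower bound both for
    [zt] and for every equilibrium. *)
Lemma strength_pos_gt (z : R) : 0 < z < 1 -> 0 < strength z -> exp (-1) < z.
Proof.
  intros Hz Hs.
  apply Rnot_le_lt; intros Hle.
  assert (ln z <= -1) by (rewrite <- (ln_exp (-1)); apply ln_le; lra).
  assert (0 < (1 - z ^ 2) / z ^ 3)
    by (apply Rdiv_lt_0_compat; [nra | apply pow_lt; lra]).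
  unfold strength, Rdiv in *; nra.
Qed.

(** At a root of [tilt], [1 + ln z = z ^ 2]. The logarithm disappears, so an enclosure of [zt]
    yields one of [alphat]. *)
Lemma strength_tilt (z : R) : 0 < z -> tilt z = 0 ->
  strength z = (1 - z ^ 2) / z.
Proof.
  unfold strength, tilt; intros Hz Ht.
  replace (1 + ln z) with (z ^ 2) by lra; field; lra.
Qed.

(** The same elimination of the logarithm at a root of [turning]; it serves to bound [alpha1] from
    above. *)
Lemma strength_turning (z : R) : 0 < z < 1 -> turning z = 0 ->
  strength z = (1 - z ^ 2) ^ 2 / (z ^ 3 * (3 - z ^ 2)).
Proof.
  unfold strength, turning; intros Hz Ht.
  replace (1 + ln z) with ((1 - z ^ 2) / (3 - z ^ 2)) by
    (apply (Rmult_eq_reg_l (3 - z ^ 2)); [field_simplify; nra | nra]).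
  field; split; nra.
Qed.

(** The window is this narrow because the closed form of [strength z1] magnifies an error in [z1]
    about fifteen times, and [alpha1 < 1.854] is to follow from it. *)
Lemma exists_turning_root : exists z, 0.48505 < z < 0.48515 /\ turning z = 0.
Proof.
  apply (IVT_derive_down turning (fun z => 2 * z * ln z - (3 - z ^ 2) / z)).
  - intros c Hc; apply is_derive_turning; lra.
  - lra.
  - unfold turning.
    pose proof (ln_bounds 0.48505 _ ltac:(lra) eq_refl) as B1.
    pose proof (ln_bounds 0.48515 _ ltac:(lra) eq_refl) as B2.
    unfold artanh_poly in *; lra.
Qed.

Lemma exists_tilt_root : exists z, 0.4507 < z < 0.4508 /\ tilt z = 0.
Proof.
  apply (IVT_derive_up tilt (fun z => (1 - 2 * z ^ 2) / z)).
  - intros c Hc; apply is_derive_tilt; lra.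
  - lra.
  - unfold tilt.
    pose proof (ln_bounds 0.4507 _ ltac:(lra) eq_refl) as B1.
    pose proof (ln_bounds 0.4508 _ ltac:(lra) eq_refl) as B2.
    unfold artanh_poly in *; lra.
Qed.

(** The maximum [alpha1] is at least the value at any sample point, so a rational point near [z1]
    suffices for its lower bound. *)
Lemma strength_0485 : 1.852 < strength 0.485.
Proof.
  unfold strength.
  pose proof (ln_bounds 0.485 _ ltac:(lra) eq_refl) as B1.
  unfold artanh_poly in *; lra.
Qed.

(** With [strength_053], this brackets the level [alphat] on the decreasing branch and puts [ztt]
    within 0.001 of 0.529. *)
Lemma strength_0528 : 1.769 < strength 0.528.
Proof.
  unfold strength.
  pose proof (ln_bounds 0.528 _ ltac:(lra) eq_refl) as B1.
  unfold artanh_poly in *; lra.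
Qed.

Lemma strength_053 : strength 0.53 < 1.767.
Proof.
  unfold strength.
  pose proof (ln_bounds 0.53 _ ltac:(lra) eq_refl) as B1.
  unfold artanh_poly in *; lra.
Qed.

(** * Force and Hessian along the equilibrium curve *)

Lemma energy_scale_pos (C sigma alpha : R) : 0 < C -> 0 < sigma -> 0 < alpha ->
  0 < 4 * C * alpha * sigma ^ 2.
Proof.
  intros HC Hs Ha; repeat apply Rmult_lt_0_compat; lra.
Qed.

Lemma force_strength (C sigma alpha z : R) : 0 < z < 1 ->
  force C sigma alpha z =
  4 * C * alpha * sigma ^ 2 * (z ^ 3 / (1 - z ^ 2)) * (alpha - strength z).
Proof.
  intros Hz; rewrite force_formula by exact Hz.
  unfold strength; field; split; nra.
Qed.

Lemma force_zero_iff (C sigma alpha z : R) :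
  0 < C -> 0 < sigma -> 0 < alpha -> 0 < z < 1 ->
  force C sigma alpha z = 0 <-> strength z = alpha.
Proof.
  intros HC Hs Ha Hz; rewrite force_strength by exact Hz.
  pose proof (energy_scale_pos C sigma alpha HC Hs Ha).
  assert (0 < z ^ 3 / (1 - z ^ 2))
    by (apply Rdiv_lt_0_compat; [apply pow_lt; lra | nra]).
  split; [| intros ->; ring].
  intros H1; apply Rmult_integral in H1 as [H1 | H1]; [| lra].
  apply Rmult_integral in H1; lra.
Qed.

Lemma equilibrium_strength (C sigma alpha z : R) :
  0 < C -> 0 < sigma -> 0 < alpha ->
  equilibrium C sigma alpha 0 z <-> 0 < z < 1 /\ strength z = alpha.
Proof.
  intros HC Hs Ha; rewrite equilibrium0_force.
  split; intros [Hz H]; split; try exact Hz;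
    apply (force_zero_iff C sigma alpha z HC Hs Ha Hz), H.
Qed.

Lemma hess11_tilt (C sigma z : R) : 0 < z < 1 ->
  hess11 C sigma (strength z) z =
  - (4 * C * strength z * sigma ^ 2 * / z) * tilt z.
Proof.
  intros Hz; rewrite hess11_formula.
  replace (strength z * z + ln z) with (tilt z / z ^ 2)
    by (unfold strength, tilt; field; lra).
  field; lra.
Qed.

Lemma hess22_turning (C sigma z : R) : 0 < z < 1 ->
  hess22 C sigma (strength z) z =
  4 * C * strength z * sigma ^ 2 * / (z * (1 - z ^ 2)) * turning z.
Proof.
  intros Hz; rewrite hess22_formula by exact Hz.
  replace (1 / z + strength z * ((z ^ 2 - 3) * z ^ 2 / (1 - z ^ 2) ^ 2))
    with (/ (z * (1 - z ^ 2)) * turning z)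
    by (unfold strength, turning; field; repeat split; nra).
  ring.
Qed.

Lemma hess11_scale_pos (C sigma z : R) :
  0 < C -> 0 < sigma -> 0 < z < 1 -> 0 < strength z ->
  0 < 4 * C * strength z * sigma ^ 2 * / z.
Proof.
  intros HC Hs Hz Ha; apply Rmult_lt_0_compat.
  - apply energy_scale_pos; assumption.
  - apply Rinv_0_lt_compat; lra.
Qed.

Lemma hess22_scale_pos (C sigma z : R) :
  0 < C -> 0 < sigma -> 0 < z < 1 -> 0 < strength z ->
  0 < 4 * C * strength z * sigma ^ 2 * / (z * (1 - z ^ 2)).
Proof.
  intros HC Hs Hz Ha; apply Rmult_lt_0_compat.
  - apply energy_scale_pos; assumption.
  - apply Rinv_0_lt_compat; apply Rmult_lt_0_compat; nra.
Qed.

Lemma hess11_pos (C sigma z : R) :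
  0 < C -> 0 < sigma -> 0 < z < 1 -> 0 < strength z -> tilt z < 0 ->
  0 < hess11 C sigma (strength z) z.
Proof.
  intros HC Hs Hz Ha Ht; rewrite hess11_tilt by exact Hz.
  pose proof (hess11_scale_pos C sigma z HC Hs Hz Ha); nra.
Qed.

Lemma hess11_neg (C sigma z : R) :
  0 < C -> 0 < sigma -> 0 < z < 1 -> 0 < strength z -> 0 < tilt z ->
  hess11 C sigma (strength z) z < 0.
Proof.
  intros HC Hs Hz Ha Ht; rewrite hess11_tilt by exact Hz.
  pose proof (hess11_scale_pos C sigma z HC Hs Hz Ha); nra.
Qed.

Lemma hess22_pos (C sigma z : R) :
  0 < C -> 0 < sigma -> 0 < z < 1 -> 0 < strength z -> 0 < turning z ->
  0 < hess22 C sigma (strength z) z.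
Proof.
  intros HC Hs Hz Ha Ht; rewrite hess22_turning by exact Hz.
  pose proof (hess22_scale_pos C sigma z HC Hs Hz Ha); nra.
Qed.

Lemma hess22_neg (C sigma z : R) :
  0 < C -> 0 < sigma -> 0 < z < 1 -> 0 < strength z -> turning z < 0 ->
  hess22 C sigma (strength z) z < 0.
Proof.
  intros HC Hs Hz Ha Ht; rewrite hess22_turning by exact Hz.
  pose proof (hess22_scale_pos C sigma z HC Hs Hz Ha); nra.
Qed.

(** * Local minimality and its failure *)

Lemma is_derive_Derive_W_z (C sigma alpha z : R) : 0 < z < 1 ->
  is_derive (Derive (fun z' => W C sigma alpha 0 z')) z
    (hess22 C sigma alpha z).
Proof.
  intros Hz; rewrite hess22_formula by exact Hz.
  apply (is_derive_ext_loc (fun z' => 4 * C * alpha * sigma ^ 2 *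
    (1 + ln z' - alpha * z' ^ 3 / (1 - z' ^ 2)))).
  - apply (locally_interval _ z 0 1); simpl; try tauto.
    intros y Hy0 Hy1; symmetry; apply Derive_W_z; split; assumption.
  - assert (0 < 1 - z ^ 2) by nra.
    auto_derive; [repeat split; lra | field; repeat split; nra].
Qed.

Lemma is_derive_force (C sigma alpha z : R) : 0 < z < 1 ->
  is_derive (fun z' => force C sigma alpha z') z (- hess22 C sigma alpha z).
Proof.
  intros Hz.
  apply (is_derive_opp (Derive (fun z' => W C sigma alpha 0 z'))).
  apply is_derive_Derive_W_z, Hz.
Qed.

(** A curve continuous at time 0 enters every neighbourhood of its starting point, so failure of
    minimality reduces to a strict maximum in one variable. *)
Lemma not_local_minimum_path (C sigma alpha phi z : R) (p q : R -> R) :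
  continuous p 0 -> continuous q 0 -> p 0 = phi -> q 0 = z -> 0 < z < 1 ->
  locally 0 (fun t => t <> 0 ->
    W C sigma alpha (p t) (q t) < W C sigma alpha phi z) ->
  ~ local_minimum C sigma alpha phi z.
Proof.
  intros Hp Hq Ep Eq Hz Hlt [d Hd].
  assert (Hp' : locally 0 (fun t => Rabs (p t - phi) < d)).
  { apply (Hp (fun x => Rabs (x - phi) < d)); rewrite Ep.
    exists d; intros y Hy; exact Hy. }
  assert (Hq' : locally 0 (fun t => Rabs (q t - z) < d)).
  { apply (Hq (fun x => Rabs (x - z) < d)); rewrite Eq.
    exists d; intros y Hy; exact Hy. }
  assert (Hq01 : locally 0 (fun t => 0 < q t < 1)).
  { apply (Hq (fun x => 0 < x < 1)); rewrite Eq.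
    apply (locally_interval _ z 0 1); simpl; tauto. }
  destruct (filter_and _ _ (filter_and _ _ Hp' Hq') (filter_and _ _ Hq01 Hlt))
    as [e He].
  (* Any nonzero time within the radius [e] gives a contradiction. *)
  destruct (He (e / 2)) as [[H1 H2] [H3 H4]].
  { change (Rabs (e / 2 - 0) < e); pose proof (cond_pos e).
    rewrite Rabs_pos_eq; lra. }
  specialize (Hd _ _ H1 H2 H3).
  specialize (H4 ltac:(pose proof (cond_pos e); lra)).
  lra.
Qed.

Lemma locally_shift (P : R -> Prop) (x : R) :
  locally x P -> locally 0 (fun t => P (x + t)).
Proof.
  intros [d Hd]; exists d; intros t Ht; apply Hd.
  change (Rabs (x + t - x) < d); change (Rabs (t - 0) < d) in Ht.
  replace (x + t - x) with (t - 0) by ring; exact Ht.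
Qed.

(** The energy descends by rotating alone: [phi = 0] is critical for the slice at fixed [z], and a
    negative [hess11] makes it a strict maximum there. *)
Lemma not_local_minimum_hess11 (C sigma alpha z : R) : 0 < z < 1 ->
  hess11 C sigma alpha z < 0 -> ~ local_minimum C sigma alpha 0 z.
Proof.
  intros Hz Hh.
  apply (not_local_minimum_path _ _ _ _ _ (fun t => t) (fun _ => z));
    try reflexivity; try exact Hz.
  - apply continuous_id.
  - apply continuous_const.
  - apply (second_derivative_max (fun phi => W C sigma alpha phi z)
      (Derive (fun phi => W C sigma alpha phi z)) 0 (hess11 C sigma alpha z)).
    + apply filter_forall; intros x; apply Derive_correct.
      eexists; apply is_derive_W_phi.
    + apply is_derive_unique, is_derive_W_phi0.
    + apply (is_derive_ext (fun phi =>
        - 4 * C * alpha ^ 2 * sigma ^ 2 * z ^ 2 * cos phi * sin phi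
        - 4 * C * alpha * sigma ^ 2 * z * ln z * sin phi)).
      { intros t; symmetry; apply is_derive_unique, is_derive_W_phi. }
      rewrite hess11_formula.
      auto_derive; [trivial | rewrite sin_0, cos_0; ring].
    + exact Hh.
Qed.

(** Here the energy descends by moving [z] alone, with [phi = 0]. *)
Lemma not_local_minimum_hess22 (C sigma alpha z : R) :
  equilibrium C sigma alpha 0 z ->
  hess22 C sigma alpha z < 0 -> ~ local_minimum C sigma alpha 0 z.
Proof.
  intros [Hz [_ Hd]] Hh.
  apply (not_local_minimum_path _ _ _ _ _ (fun _ => 0) (fun t => z + t));
    try reflexivity; try exact Hz; try ring.
  - apply continuous_const.
  - apply (continuous_plus (fun _ => z) (fun t => t));
      [apply continuous_const | apply continuous_id].
  - assert (H : locally z (fun z' => z' <> z ->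
        W C sigma alpha 0 z' < W C sigma alpha 0 z)).
    { apply (second_derivative_max _ (Derive (fun z' => W C sigma alpha 0 z'))
        z (hess22 C sigma alpha z)).
      - apply (locally_interval _ z 0 1); simpl; try tauto.
        intros y Hy0 Hy1; apply Derive_correct.
        eexists; apply is_derive_W_z; split; assumption.
      - apply is_derive_unique, Hd.
      - apply is_derive_Derive_W_z, Hz.
      - exact Hh. }
    apply locally_shift in H; revert H; apply filter_imp.
    intros t Ht Ht0; apply Ht; lra.
Qed.

(** No two-variable Taylor expansion is used: near [z], [W] at [(phi, y)] is at least [W] at
    [(0, y)], which is at least [W] at [(0, z)]. The first inequality needs [alpha * y + ln y < 0],
    which [hess11 > 0] gives at [z] and continuity nearby. *)
Lemma local_minimum_hess (C sigma alpha z : R) :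
  0 < C -> 0 < sigma -> 0 < alpha ->
  equilibrium C sigma alpha 0 z ->
  0 < hess11 C sigma alpha z -> 0 < hess22 C sigma alpha z ->
  local_minimum C sigma alpha 0 z.
Proof.
  intros HC Hs Ha [Hz [_ Hd]] H11 H22.
  assert (Hz_min : locally z (fun z' => z' <> z ->
        W C sigma alpha 0 z < W C sigma alpha 0 z')).
  { apply (second_derivative_min _ (Derive (fun z' => W C sigma alpha 0 z'))
      z (hess22 C sigma alpha z)).
    - apply (locally_interval _ z 0 1); simpl; try tauto.
      intros y Hy0 Hy1; apply Derive_correct.
      eexists; apply is_derive_W_z; split; assumption.
    - apply is_derive_unique, Hd.
    - apply is_derive_Derive_W_z, Hz.
    - exact H22. }
  assert (Hneg : locally z (fun y => alpha * y + ln y < 0)).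
  { assert (Hc : continuous (fun y => alpha * y + ln y) z).
    { apply (@ex_derive_continuous _ R_NormedModule); auto_derive; lra. }
    apply (Hc (fun x => x < 0)), (open_lt 0).
    rewrite hess11_formula in H11.
    assert (0 < 4 * C * alpha * sigma ^ 2 * z)
      by (apply Rmult_lt_0_compat; [apply energy_scale_pos |]; lra).
    nra. }
  destruct (filter_and _ _ Hz_min Hneg) as [d Hd'].
  exists d; intros phi y _ Hy Hy01.
  destruct (Hd' y Hy) as [Hmin Hn].
  apply Rle_trans with (W C sigma alpha 0 y).
  - destruct (Req_dec y z) as [-> | Hne]; [lra |].
    left; apply Hmin, Hne.
  - apply Rminus_le_0.
    (* The increment in [phi] is an exact quadratic in [1 - cos phi], so this comparison holds for
       every angle. *)
    replace (W C sigma alpha phi y - W C sigma alpha 0 y) with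
      (4 * C * alpha * sigma ^ 2 * ((y * (1 - cos phi)) *
        (alpha * y * (1 - cos phi) / 2 - (alpha * y + ln y))))
      by (unfold W; rewrite cos_0; field).
    pose proof (COS_bound phi).
    assert (0 <= alpha * y * (1 - cos phi)).
    { apply Rmult_le_pos; [apply Rmult_le_pos |]; lra. }
    apply Rmult_le_pos; [left; apply energy_scale_pos; assumption |].
    apply Rmult_le_pos; [apply Rmult_le_pos |]; lra.
Qed.

(* Here [hess11] vanishes, but in the variables [u = 1 - cos phi] and [z] the
   mixed second derivative is so negative that the energy decreases along the
   diagonal [(u, z + u)]. *)
Lemma not_local_minimum_degenerate (C sigma z : R) :
  0 < C -> 0 < sigma -> 0.45 < z < 0.451 -> tilt z = 0 ->
  ~ local_minimum C sigma (strength z) 0 z.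
Proof.
  intros HC Hs Hz Ht.
  set (alpha := strength z).
  assert (Ea : alpha = (1 - z ^ 2) / z) by (apply strength_tilt; lra).
  assert (El : ln z = z ^ 2 - 1) by (unfold tilt in Ht; lra).
  (* [E u] is the energy at [z + u] with [cos phi] replaced by [1 - u]. It makes sense for [u] of
     both signs, so the one-variable test applies at 0, although angles only give [u >= 0]. *)
  set (E := fun u => 2 * C * alpha * sigma ^ 2 *
    (alpha * (z + u) ^ 2 * (1 - u) ^ 2 + alpha * ln (1 - (z + u) ^ 2)
      + 2 * (z + u) * ln (z + u) * (1 - u)) + C / 2 * sigma ^ 2).
  set (dE := fun u => 2 * C * alpha * sigma ^ 2 *
    (2 * alpha * (z + u) * (1 - u) ^ 2 - 2 * alpha * (z + u) ^ 2 * (1 - u)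
      - 2 * alpha * (z + u) / (1 - (z + u) ^ 2)
      + 2 * (ln (z + u) + 1) * (1 - u) - 2 * (z + u) * ln (z + u))).
  assert (Hmax : locally 0 (fun u => u <> 0 -> E u < E 0)).
  { apply (second_derivative_max E dE 0 (2 * C * alpha * sigma ^ 2 *
      (2 * alpha - 8 * alpha * z + 2 * alpha * z ^ 2
       - 2 * alpha * (1 + z ^ 2) / (1 - z ^ 2) ^ 2 + 2 / z
       - 4 * (ln z + 1)))).
    (* The radius 0.4 keeps [z + u] inside [(0, 1)]. *)
    - apply (locally_interval _ 0 (- 0.4) 0.4); simpl; try lra.
      intros u Hu0 Hu1; unfold E, dE.
      assert (0 < 1 - (z + u) ^ 2) by nra.
      auto_derive; [repeat split; lra | field; repeat split; nra].
    (* Both partial derivatives vanish: the one in [u] because [alpha * z + ln z = 0], the one in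
       [z] by equilibrium. *)
    - unfold dE; rewrite !Rplus_0_r, Rminus_0_r, El, Ea; field; split; nra.
    - unfold dE; assert (0 < 1 - z ^ 2) by nra.
      auto_derive; [rewrite Rplus_0_r; repeat split; nra |].
      rewrite !Rplus_0_r; field; repeat split; nra.
    - assert (Hal : 0 < alpha) by (rewrite Ea; apply Rdiv_lt_0_compat; nra).
      pose proof (energy_scale_pos C sigma alpha HC Hs Hal).
      (* With [ln z] and [alpha] eliminated, the mixed derivative contributes
         [- 8 * (1 - z ^ 2) - 4 * z ^ 2], which outweighs [2 * alpha < 3.6] and the small remaining
         positive term. *)
      replace (2 * alpha - 8 * alpha * z + 2 * alpha * z ^ 2
       - 2 * alpha * (1 + z ^ 2) / (1 - z ^ 2) ^ 2 + 2 / z - 4 * (ln z + 1))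
        with (2 * alpha - 8 * (1 - z ^ 2) + 2 * z * (1 - z ^ 2)
              - 4 * (z / (1 - z ^ 2)) - 4 * z ^ 2)
        by (rewrite El, Ea; field; split; nra).
      assert (0 < z / (1 - z ^ 2)) by (apply Rdiv_lt_0_compat; nra).
      assert (alpha < 1.8) by (rewrite Ea; apply Rlt_div_l; nra).
      assert (2 * alpha - 8 * (1 - z ^ 2) + 2 * z * (1 - z ^ 2)
              - 4 * (z / (1 - z ^ 2)) - 4 * z ^ 2 < 0) by nra.
      nra. }
  assert (Hcos : continuous (fun t => 1 - cos t) 0)
    by (apply (@ex_derive_continuous _ R_NormedModule); auto_derive; trivial).
  apply (not_local_minimum_path _ _ _ _ _ (fun t => t)
    (fun t => z + (1 - cos t))); try lra.
  - apply continuous_id.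
  - apply (continuous_plus (fun _ => z)); [apply continuous_const | exact Hcos].
  - rewrite cos_0; ring.
  - assert (HW : locally 0 (fun t => 1 - cos t <> 0 ->
      E (1 - cos t) < E 0)).
    { apply (Hcos (fun u => u <> 0 -> E u < E 0)).
      rewrite cos_0, Rminus_diag; exact Hmax. }
    assert (H1 : locally 0 (fun t => -1 < t < 1))
      by (apply (locally_interval _ 0 (-1) 1); simpl; try lra; tauto).
    generalize (filter_and _ _ HW H1); apply filter_imp.
    intros t [Hlt Ht1] Ht0.
    replace (W C sigma alpha t (z + (1 - cos t))) with (E (1 - cos t)).
    2: { unfold E, W; replace (1 - (1 - cos t)) with (cos t) by ring; field. }
    replace (W C sigma alpha 0 z) with (E 0).
    2: { unfold E, W; rewrite cos_0, Rplus_0_r, Rminus_0_r; field. }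
    apply Hlt.
    (* For [0 < |t| < 1], [1 - cos t = 2 sin^2 (t / 2)] is nonzero, so the curve really leaves the
       point. *)
    replace (cos t) with (cos (2 * (t / 2))) by (f_equal; field).
    rewrite cos_2a_sin.
    pose proof PI2_1.
    assert (Hsin : sin (t / 2) <> 0).
    { destruct (Rtotal_order t 0) as [H0 | [H0 | H0]].
      - pose proof (sin_gt_0 (- (t / 2)) ltac:(lra) ltac:(lra)) as Hsg.
        rewrite sin_neg in Hsg; lra.
      - lra.
      - pose proof (sin_gt_0 (t / 2) ltac:(lra) ltac:(lra)); lra. }
    nra.
Qed.

(** * Classification of the equilibria *)

Theorem mainTheorem2 (C sigma : R) (HC : 0 < C) (Hsigma : 0 < sigma) :
  exists alpha1 z1 alphat zt ztt : R,
    unique (fun p : R * R =>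
        0 < fst p /\ 0 < snd p < 1 /\
        force C sigma (fst p) (snd p) = 0 /\
        is_derive (fun z => force C sigma (fst p) z) (snd p) 0)
      (alpha1, z1) /\
    unique (fun p : R * R =>
        0 < fst p < alpha1 /\ 0 < snd p < z1 /\
        force C sigma (fst p) (snd p) = 0 /\
        hess11 C sigma (fst p) (snd p) = 0)
      (alphat, zt) /\
    unique (fun z : R => 0 < z < 1 /\ z <> zt /\ force C sigma alphat z = 0)
      ztt /\
    (exp (-1) < zt /\ zt < z1 /\ z1 < ztt /\ ztt < 1) /\
    alphat = (1 - zt ^ 2) / zt /\
    (Rabs (alpha1 - 1.853) <= 0.001 /\
     Rabs (z1 - 0.485) <= 0.001 /\
     Rabs (alphat - 1.768) <= 0.001 /\
     Rabs (zt - 0.451) <= 0.001 /\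
     Rabs (ztt - 0.529) <= 0.001) /\
    (forall alpha z : R, 0 < alpha ->
       (equilibrium C sigma alpha 0 z <->
        0 < z < 1 /\ force C sigma alpha z = 0)) /\
    (forall alpha z : R, 0 < alpha ->
       equilibrium C sigma alpha 0 z -> exp (-1) < z) /\
    (* (i) *)
    (forall alpha : R, 0 < alpha < alphat ->
       exists za zb : R,
         (forall z : R,
            equilibrium C sigma alpha 0 z <-> z = za \/ z = zb) /\
         (exp (-1) < za < zt /\
          0 < hess11 C sigma alpha za /\ 0 < hess22 C sigma alpha za /\
          stable C sigma alpha 0 za) /\
         (ztt < zb < 1 /\
          hess11 C sigma alpha zb < 0 /\ hess22 C sigma alpha zb < 0 /\
          unstable C sigma alpha 0 zb)) /\
    (* (ii) *)
    ((forall z : R,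
        equilibrium C sigma alphat 0 z <-> z = zt \/ z = ztt) /\
     (hess11 C sigma alphat zt = 0 /\ 0 < hess22 C sigma alphat zt /\
      unstable C sigma alphat 0 zt) /\
     (hess11 C sigma alphat ztt < 0 /\ hess22 C sigma alphat ztt < 0 /\
      unstable C sigma alphat 0 ztt)) /\
    (* (iii) *)
    (forall alpha : R, alphat < alpha < alpha1 ->
       exists za zb : R,
         (forall z : R,
            equilibrium C sigma alpha 0 z <-> z = za \/ z = zb) /\
         (zt < za < z1 /\
          hess11 C sigma alpha za < 0 /\ 0 < hess22 C sigma alpha za /\
          unstable C sigma alpha 0 za) /\
         (z1 < zb < ztt /\
          hess11 C sigma alpha zb < 0 /\ hess22 C sigma alpha zb < 0 /\
          unstable C sigma alpha 0 zb)) /\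
    (* (iv) *)
    ((forall z : R, equilibrium C sigma alpha1 0 z <-> z = z1) /\
     hess11 C sigma alpha1 z1 < 0 /\ hess22 C sigma alpha1 z1 = 0 /\
     unstable C sigma alpha1 0 z1) /\
    (* (v) *)
    (forall alpha : R, alpha1 < alpha ->
       forall z : R, ~ equilibrium C sigma alpha 0 z).
Proof.
  destruct exists_turning_root as [z1 [Hz1 T1]].
  destruct exists_tilt_root as [zt [Hzt Tt]].
  pose proof (strength_tilt zt ltac:(lra) Tt) as Et.
  assert (Hat : 1.767 < strength zt < 1.769).
  { assert (0.4507 ^ 2 < zt ^ 2 < 0.4508 ^ 2) by nra.
    rewrite Et; split.
    - apply (proj1 (Rlt_div_r 1.767 _ zt ltac:(lra))); lra.
    - apply (proj2 (Rlt_div_l _ 1.769 zt ltac:(lra))); lra. }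
  destruct (IVT_derive_down strength (fun z => turning z / z ^ 4)
    0.528 0.53 (strength zt)) as [ztt [Hztt Ett]].
  { intros c Hc; apply is_derive_strength; lra. }
  { lra. }
  { pose proof strength_0528; pose proof strength_053; lra. }
  (* The lower bound comes from maximality against the sample point 0.485, the upper one from the
     closed form at [z1]. *)
  assert (Ha1 : 1.852 < strength z1 < 1.854).
  { split.
    - apply Rlt_le_trans with (1 := strength_0485).
      apply strength_le_max; lra.
    - rewrite strength_turning by (exact T1 || lra).
      assert (0.48505 ^ 2 < z1 ^ 2 < 0.48515 ^ 2) by nra.
      assert (0.48505 ^ 3 < z1 ^ 3) by nra.
      apply Rlt_div_l; nra. }
  assert (Hexp : exp (-1) < zt) by (apply strength_pos_gt; lra).
  pose proof (exp_pos (-1)) as Hexp0.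
  assert (Inc : forall x y, 0 < x -> x < y -> y <= z1 ->
    strength x < strength y) by (intros; apply (strength_increasing z1); lra).
  assert (Dec : forall x y, z1 <= x -> x < y -> y <= 1 ->
    strength y < strength x) by (intros; apply (strength_decreasing z1); lra).
  assert (Tpos : forall z, 0 < z < z1 -> 0 < turning z)
    by (intros; rewrite <- T1; apply turning_decreasing; lra).
  assert (Tneg : forall z, z1 < z < 1 -> turning z < 0)
    by (intros; rewrite <- T1; apply turning_decreasing; lra).
  assert (Lpos : forall z, zt < z < 1 -> 0 < tilt z)
    by (intros; apply (tilt_pos zt); lra).
  assert (Lneg : forall z, 0 < z < zt -> tilt z < 0)
    by (intros; rewrite <- Tt; apply tilt_increasing; lra).
  (* Strict monotonicity on each side of [z1] allows one root per side, so listing the equilibria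
     for a given [alpha] amounts to exhibiting one root on each branch. *)
  assert (Two : forall alpha za zb, 0 < alpha -> 0 < za < z1 -> z1 < zb < 1 ->
    strength za = alpha -> strength zb = alpha ->
    forall z, equilibrium C sigma alpha 0 z <-> z = za \/ z = zb).
  { intros alpha za zb Ha Hza Hzb Ea Eb z.
    rewrite equilibrium_strength by assumption; split.
    - intros [Hz Ez].
      destruct (Rle_or_lt z z1) as [Hle | Hlt].
      + left; destruct (Rtotal_order z za) as [H | [H | H]]; [| exact H |].
        * pose proof (Inc z za); lra.
        * pose proof (Inc za z); lra.
      + right; destruct (Rtotal_order z zb) as [H | [H | H]]; [| exact H |].
        * pose proof (Dec z zb); lra.
        * pose proof (Dec zb z); lra.
    - intros [-> | ->]; (split; [lra | assumption]). }
  assert (Eqt := Two (strength zt) zt ztt ltac:(lra) ltac:(lra) ltac:(lra)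
    eq_refl Ett).
  exists (strength z1), z1, (strength zt), zt, ztt.
  split; [| split; [| split; [| split; [| split; [| split; [| split;
    [| split; [| split; [| split; [| split; [| split]]]]]]]]]]].
  - split; simpl.
    + split; [lra |]; split; [lra |]; split.
      * apply force_zero_iff; lra.
      * replace 0 with (- hess22 C sigma (strength z1) z1).
        { apply is_derive_force; lra. }
        rewrite hess22_turning, T1 by lra; ring.
    + intros [a z]; simpl; intros [Ha [Hz [Hf Hd]]].
      (* Zero force determines the first component from [z]; what remains is uniqueness of the root
         of [turning]. *)
      apply force_zero_iff in Hf; try assumption; subst a.
      assert (D : 0 = - hess22 C sigma (strength z) z).
      { rewrite <- (is_derive_unique _ _ _ Hd).
        apply is_derive_unique, is_derive_force, Hz. }
      rewrite hess22_turning in D by exact Hz.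
      pose proof (hess22_scale_pos C sigma z HC Hsigma Hz Ha).
      assert (z1 = z) as <-; [| reflexivity].
      destruct (Rtotal_order z1 z) as [H0 | [H0 | H0]]; [| exact H0 |].
      * pose proof (Tneg z); nra.
      * pose proof (Tpos z); nra.
  - split; simpl.
    + split; [lra |]; split; [lra |]; split.
      * apply force_zero_iff; lra.
      * rewrite hess11_tilt, Tt by lra; ring.
    + intros [a z]; simpl; intros [Ha [Hz [Hf Hd]]].
      apply force_zero_iff in Hf; try lra; subst a.
      rewrite hess11_tilt in Hd by lra.
      pose proof (hess11_scale_pos C sigma z HC Hsigma ltac:(lra) ltac:(lra)).
      assert (zt = z) as <-; [| reflexivity].
      destruct (Rtotal_order zt z) as [H0 | [H0 | H0]]; [| exact H0 |].
      * pose proof (Lpos z); nra.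
      * pose proof (Lneg z); nra.
  - split.
    + split; [lra |]; split; [lra |].
      apply force_zero_iff; lra.
    + intros z [Hz [Hne Hf]].
      destruct (proj1 (Eqt z)) as [E | E]; [| contradiction | symmetry; exact E].
      apply equilibrium0_force; split; assumption.
  - lra.
  - exact Et.
  - repeat split; apply Rabs_le; lra.
  - intros; apply equilibrium0_force.
  - intros alpha z Ha He.
    apply equilibrium_strength in He as [Hz Es]; try assumption.
    apply strength_pos_gt; lra.
  - intros alpha Ha.
    (* Both branches reach the level 0, at [exp (-1)] and at 1, so every [alpha] in [(0, alphat)] is
       attained beyond [zt] on the left and beyond [ztt] on the right. *)
    destruct (IVT_derive_up strength (fun z => turning z / z ^ 4)
      (exp (-1)) zt alpha) as [za [Hza Ea]].
    { intros c Hc; apply is_derive_strength; lra. }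
    { exact Hexp. }
    { rewrite strength_exp; lra. }
    destruct (IVT_derive_down strength (fun z => turning z / z ^ 4)
      ztt 1 alpha) as [zb [Hzb Eb]].
    { intros c Hc; apply is_derive_strength; lra. }
    { lra. }
    { rewrite strength_1; lra. }
    assert (Eq := Two alpha za zb ltac:(lra) ltac:(lra) ltac:(lra) Ea Eb).
    exists za, zb; split; [exact Eq |].
    assert (QA : equilibrium C sigma alpha 0 za) by (apply Eq; left; reflexivity).
    assert (QB : equilibrium C sigma alpha 0 zb) by (apply Eq; right; reflexivity).
    assert (A11 : 0 < hess11 C sigma alpha za).
    { rewrite <- Ea; apply hess11_pos; try lra; apply Lneg; lra. }
    assert (A22 : 0 < hess22 C sigma alpha za).
    { rewrite <- Ea; apply hess22_pos; try lra; apply Tpos; lra. }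
    assert (B11 : hess11 C sigma alpha zb < 0).
    { rewrite <- Eb; apply hess11_neg; try lra; apply Lpos; lra. }
    assert (B22 : hess22 C sigma alpha zb < 0).
    { rewrite <- Eb; apply hess22_neg; try lra; apply Tneg; lra. }
    split; (split; [lra |]; split; [assumption |]; split; [assumption |]);
      (split; [assumption |]).
    + apply local_minimum_hess; try assumption; lra.
    + apply not_local_minimum_hess22; assumption.
  - split; [exact Eqt |].
    assert (QA : equilibrium C sigma (strength zt) 0 zt)
      by (apply Eqt; left; reflexivity).
    assert (QB : equilibrium C sigma (strength zt) 0 ztt)
      by (apply Eqt; right; reflexivity).
    assert (B22 : hess22 C sigma (strength zt) ztt < 0).
    { rewrite <- Ett; apply hess22_neg; try lra; apply Tneg; lra. }
    split; (split; [| split; [| split; [assumption |]]]).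
    + rewrite hess11_tilt, Tt by lra; ring.
    + apply hess22_pos; try lra; apply Tpos; lra.
    + apply not_local_minimum_degenerate; lra.
    + rewrite <- Ett; apply hess11_neg; try lra; apply Lpos; lra.
    + exact B22.
    + apply not_local_minimum_hess22; assumption.
  - intros alpha Ha.
    destruct (IVT_derive_up strength (fun z => turning z / z ^ 4)
      zt z1 alpha) as [za [Hza Ea]].
    { intros c Hc; apply is_derive_strength; lra. }
    { lra. }
    { lra. }
    destruct (IVT_derive_down strength (fun z => turning z / z ^ 4)
      z1 ztt alpha) as [zb [Hzb Eb]].
    { intros c Hc; apply is_derive_strength; lra. }
    { lra. }
    { lra. }
    assert (Eq := Two alpha za zb ltac:(lra) ltac:(lra) ltac:(lra) Ea Eb).
    exists za, zb; split; [exact Eq |].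
    assert (QA : equilibrium C sigma alpha 0 za) by (apply Eq; left; reflexivity).
    assert (QB : equilibrium C sigma alpha 0 zb) by (apply Eq; right; reflexivity).
    assert (A11 : hess11 C sigma alpha za < 0).
    { rewrite <- Ea; apply hess11_neg; try lra; apply Lpos; lra. }
    assert (A22 : 0 < hess22 C sigma alpha za).
    { rewrite <- Ea; apply hess22_pos; try lra; apply Tpos; lra. }
    assert (B11 : hess11 C sigma alpha zb < 0).
    { rewrite <- Eb; apply hess11_neg; try lra; apply Lpos; lra. }
    assert (B22 : hess22 C sigma alpha zb < 0).
    { rewrite <- Eb; apply hess22_neg; try lra; apply Tneg; lra. }
    (* Both roots lie to the right of [zt], where [hess11] is negative, so the same rotation
       destabilizes both. *)
    split; (split; [lra |]; split; [assumption |]; split; [assumption |]);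
      (split; [assumption |]);
      apply not_local_minimum_hess11; (assumption || lra).
  - assert (H11 : hess11 C sigma (strength z1) z1 < 0).
    { apply hess11_neg; try lra; apply Lpos; lra. }
    split; [| split; [exact H11 |]; split; [| split]].
    + intros z; rewrite equilibrium_strength by lra; split.
      * intros [Hz Ez].
        destruct (Rtotal_order z z1) as [H | [H | H]]; [| exact H |].
        { pose proof (Inc z z1); lra. }
        { pose proof (Dec z1 z); lra. }
      * intros ->; split; [lra | reflexivity].
    + rewrite hess22_turning, T1 by lra; ring.
    + apply equilibrium_strength; lra.
    + apply not_local_minimum_hess11; (assumption || lra).
  - intros alpha Ha z He.
    apply equilibrium_strength in He as [Hz Es]; try lra.
    pose proof (strength_le_max z1 z T1 ltac:(lra) ltac:(lra)); lra.
Qed.
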